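(* Let $H$ be a finite set of hypotheses, $X$ a finite set of possible example inputs, $q$ a query, and $B$ a finite output alphabet, where each $h\in H$ has an associated response function $h:X\cup\{q\}\to B$. Let $V\subseteq H$ be the version space after a fixed background context. A set $E\subseteq X$ determines $q$ relative to $V$ if and only if \[ P_q(V)\subseteq\bigcup_{x\in E}\operatorname{Sep}_x(V). \] Equivalently, finite-context determination of $q$ is exactly a hitting problem over query-disagreement pairs.
   Context: Determination: after observing a labeled example set $E\subseteq X$, the version space is $H_E:=\{h\in H: h(x)=b_x \text{ for all } x\in E\}$, where $b_x$ is the observed label of $x$; the query $q$ is determined by $E$ if all hypotheses in $H_E$ have the same value at $q$. Determination relative to $V$ is the same notion with the hypothesis set $H$ replaced by $V$, i.e. all hypotheses in $\{h\in V: h(x)=b_x\text{ for all }x\in E\}$ have the same value at $q$. For a fixed realized version space $V\subseteq H$, the query-disagreement pairs are $P_q(V):=\{\{h,h'\}\subseteq V:h(q)\neq h'(q)\}$, and for $x\in X$, $\operatorname{Sep}_x(V):=\{\{h,h'\}\in P_q(V):h(x)\neq h'(x)\}$ is the set of query-disagreement pairs separated by $x$.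
   Formalization: ''E determines q relative to V'' is taken to mean that q is determined for every possible labelling b of the examples in E, not just for one fixed observed labelling, since for a single fixed labelling the ''only if'' direction is false. *)

(* Defs.v *)
From mathcomp Require Import all_boot.

Set Implicit Arguments.
Unset Strict Implicit.
Unset Printing Implicit Defensive.

(* [H] is the finite set of hypotheses and [resp h] is the response function of
   [h]; it need not be injective in [h]. The inputs are points of a finite type
   [I] containing the example inputs and the query [q] ([q] may or may not be
   an example input). *)

Definition version_space (H I B : finType) (resp : H -> I -> B)
    (V : {set H}) (E : {set I}) (b : I -> B) : {set H} :=
  [set h in V | [forall x in E, resp h x == b x]].

Definition determined_by_labels (H I B : finType) (resp : H -> I -> B)
    (V : {set H}) (q : I) (E : {set I}) (b : I -> B) : Prop :=
  forall h h' : H,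
    h \in version_space resp V E b -> h' \in version_space resp V E b ->
    resp h q = resp h' q.

(* Determination is a property of the set [E] of inputs alone, so it is required
   whatever labels are observed on [E]. Labels that no hypothesis of [V] realizes
   give an empty version space and impose nothing. *)
Definition determines (H I B : finType) (resp : H -> I -> B)
    (V : {set H}) (q : I) (E : {set I}) : Prop :=
  forall b : I -> B, determined_by_labels resp V q E b.

(* Unordered pairs {h, h'} are represented as sets of hypotheses. *)
Definition disagreement_pairs (H I B : finType) (resp : H -> I -> B)
    (V : {set H}) (q : I) : {set {set H}} :=
  [set [set h; h'] | h in V, h' in V & resp h q != resp h' q].

Definition Sep (H I B : finType) (resp : H -> I -> B)
    (V : {set H}) (q x : I) : {set {set H}} :=
  [set p in disagreement_pairs resp V q |
    [exists h, exists h', (p == [set h; h']) && (resp h x != resp h' x)]].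

Definition separators (H I B : finType) (resp : H -> I -> B)
    (V : {set H}) (q : I) (X : {set I}) (p : {set H}) : {set I} :=
  [set x in X | p \in Sep resp V q x].

Definition hitting_set (I : finType) (E : {set I}) (F : {set {set I}}) : Prop :=
  forall A : {set I}, A \in F -> E :&: A != set0.

(* Main.v *)
Require Import Defs.
From mathcomp Require Import all_boot.

(** By taking the responses of one hypothesis as the labels, [E] determines [q]
    iff any two hypotheses of [V] that disagree at [q] already disagree somewhere
    on [E]; the covering and the hitting conditions both unfold to this. *)

Lemma determines_separated {H I B : finType} (resp : H -> I -> B)
    (V : {set H}) (q : I) (E : {set I}) :
  determines resp V q E <->
  {in V &, forall h h', resp h q != resp h' q ->
     exists2 x, x \in E & resp h x != resp h' x}.
Proof.
split=> [detE h h' Vh Vh' neq_q | sepE b h h'].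
  apply/exists_inP; apply: contraR neq_q; rewrite negb_exists_in => agreeE.
  (* If no input of [E] separates [h] from [h'], both fit the labels [resp h] and so lie in one
     version space. *)
  apply/eqP/(detE (resp h)); rewrite inE ?Vh ?Vh' /=; apply/forall_inP => // x Ex.
  by rewrite eq_sym -[_ == _]negbK (forall_inP agreeE).
rewrite !inE => /andP[Vh /forall_inP hE] /andP[Vh' /forall_inP h'E].
apply/eqP/negPn/negP => /(sepE h h' Vh Vh')[x Ex].
by rewrite (eqP (hE x Ex)) (eqP (h'E x Ex)) eqxx.
Qed.

(** [Sep] asks only for some presentation of the pair with disagreement at [x]; since a pair fixes
    its members up to order and disagreement is symmetric, any presentation can be tested
    instead. *)
Lemma mem_Sep_set2 {H I B : finType} {resp : H -> I -> B} {V : {set H}} {q : I}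
    {h h' : H} (x : I) :
  h \in V -> h' \in V -> resp h q != resp h' q ->
  ([set h; h'] \in Sep resp V q x) = (resp h x != resp h' x).
Proof.
move=> Vh Vh' neq_q; rewrite inE.
have -> /= : [set h; h'] \in disagreement_pairs resp V q.
  by apply: imset2_f; rewrite ?inE ?Vh'.
apply/existsP/idP => [[g /existsP[g' /andP[/eqP eq_gh]]] | neq_x].
  (* Each of [g], [g'] is [h] or [h']: the two cases with [g = g'] contradict disagreement at [x],
     and the swapped case follows by symmetry. *)
  have := set21 g g'; have := set22 g g'; rewrite -eq_gh !inE.
  by do 2![case/pred2P=> ->]; rewrite ?eqxx // eq_sym.
by exists h; apply/existsP; exists h'; rewrite eqxx.
Qed.

Lemma determines_cover {H I B : finType} (resp : H -> I -> B)
    (V : {set H}) (q : I) (E : {set I}) :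
  determines resp V q E <->
  disagreement_pairs resp V q \subset \bigcup_(x in E) Sep resp V q x.
Proof.
split=> [/determines_separated sepE | /subsetP coverE].
  apply/subsetP => _ /imset2P[h h' Vh /[!inE] /andP[Vh' neq_q] ->].
  have [x Ex neq_x] := sepE h h' Vh Vh' neq_q.
  by apply/bigcupP; exists x; rewrite ?mem_Sep_set2.
apply/determines_separated => h h' Vh Vh' neq_q.
have /coverE/bigcupP[x Ex] : [set h; h'] \in disagreement_pairs resp V q.
  by apply: imset2_f; rewrite ?inE ?Vh'.
by rewrite mem_Sep_set2 //; exists x.
Qed.

(** Covering and hitting read the same incidence between inputs and pairs from its two sides: for
    [x] in [X], [p] lies in [Sep resp V q x] exactly when [x] lies in [separators resp V q X p]. The
    inclusion of [E] in [X] places a covering input among the separators. *)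
Lemma cover_hitting_set {H I B : finType} (resp : H -> I -> B)
    (V : {set H}) (q : I) {X E : {set I}} :
  E \subset X ->
  disagreement_pairs resp V q \subset \bigcup_(x in E) Sep resp V q x <->
  hitting_set E
    [set separators resp V q X p | p in disagreement_pairs resp V q].
Proof.
move=> /subsetP sEX; split=> [/subsetP coverE _ /imsetP[p Pp ->] | hitE].
  have /bigcupP[x Ex Sep_p] := coverE p Pp.
  by apply/set0Pn; exists x; rewrite in_setI Ex in_set sEX.
apply/subsetP => p Pp; have /set0Pn[x] := hitE _ (imset_f _ Pp).
by rewrite inE => /andP[Ex]; rewrite inE => /andP[_ Sep_p]; apply/bigcupP; exists x.
Qed.

Theorem theorem4p11 (H I B : finType) (X : {set I}) (q : I)
    (resp : H -> I -> B) (V : {set H}) (E : {set I}) (hE : E \subset X) :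
  (determines resp V q E <->
     disagreement_pairs resp V q \subset \bigcup_(x in E) Sep resp V q x) /\
  (determines resp V q E <->
     hitting_set E
       [set separators resp V q X p | p in disagreement_pairs resp V q]).
Proof.
have det_cover := determines_cover resp V q E.
by split=> //; apply: iff_trans det_cover (cover_hitting_set resp V q hE).
Qed.
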